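(* Let $M\in\mathcal{LC}$ and $r\in\mathbb{N}_{\ge1}$. Let $\mathcal{A}$ be any one of the Roumieu type classes $\mathcal{D}_{r,\{M\}}([-1,1])$, $\mathcal{L}_{r,\{M\}}$, $\mathcal{N}_{r,\{M\}}$, $\mathcal{E}_{r,\{M\}}$ or of the Beurling type classes $\mathcal{D}_{r,(M)}([-1,1])$, $\mathcal{L}_{r,(M)}$, $\mathcal{N}_{r,(M)}$, $\mathcal{E}_{r,(M)}$. Then $\mathcal{A}$ is nonquasianalytic, i.e. the Borel map restricted to $\mathcal{A}$ is not injective, if and only if $$\sum_{p\ge1}\left(\frac{1}{\mu_p}\right)^{1/r}<\infty.$$
   Context: $\mathbb{N}=\{0,1,2,\dots\}$. For a sequence $M=(M_p)_{p\in\mathbb{N}}$ of positive reals put $\mu_p=M_p/M_{p-1}$ for $p\ge1$. $\mathcal{LC}$ is the set of all positive sequences $M$ that are normalized ($1=M_0\le M_1$), log-convex ($M_j^2\le M_{j-1}M_{j+1}$ for all $j\ge 1$), and satisfy $\lim_{k\to\infty}(M_k)^{1/k}=\infty$. Function classes. For an interval $I\in\{\mathbb{R},[0,\infty),[0,1]\}$ consider $\mathcal{C}^\infty$ functions $f:I\to\mathbb{C}$ (one-sided derivatives at boundary points) satisfying (a) $f^{(rn+j)}(0)=0$ for all $n\in\mathbb{N}$, $j\in\{1,\dots,r-1\}$; and (b) for some $h>0$ (Roumieu type, subscript $\{M\}$), resp. for every $h>0$ (Beurling type, subscript $(M)$), $\sup_{n\in\mathbb{N},x\in I}\frac{|f^{(rn)}(x)|}{h^nM_n}<\infty$.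 Then: $\mathcal{D}_{r,\{M\}}([-1,1])$, $\mathcal{D}_{r,(M)}([-1,1])$ consist of such $f$ with $I=\mathbb{R}$ and $\operatorname{supp}(f)\subseteq[-1,1]$; $\mathcal{L}_{r,\{M\}}$, $\mathcal{L}_{r,(M)}$ consist of such $f$ with $I=[0,\infty)$ and $\operatorname{supp}(f)\subseteq[0,1]$; $\mathcal{N}_{r,\{M\}}$, $\mathcal{N}_{r,(M)}$ consist of all such $f$ with $I=[0,\infty)$; $\mathcal{E}_{r,\{M\}}$, $\mathcal{E}_{r,(M)}$ consist of all such $f$ with $I=[0,1]$. The Borel map at $x$ is $\mathcal{B}_x(f)=(f^{(k)}(x))_{k\in\mathbb{N}}$. A class $\mathcal{A}$ of smooth functions on $I$ is called quasianalytic if $\mathcal{B}_x$ is injective on $\mathcal{A}$ for all $x\in I$, and nonquasianalytic otherwise. *)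

(* Defs.v *)
From Stdlib Require Import Reals Rtopology.
From Coquelicot Require Import Coquelicot.
Open Scope R_scope.

Definition mu (M : nat -> R) (p : nat) : R := M p / M (p - 1)%nat.

(* For [k >= 1] and [M k > 0], [Rpower (M k) (/ INR k)] is the k-th root of
   [M k]; the term [k = 0] does not affect the limit. *)
Definition LC (M : nat -> R) : Prop :=
  (forall p, 0 < M p) /\
  (M 0%nat = 1 /\ 1 <= M 1%nat) /\
  (forall j, (1 <= j)%nat -> (M j) ^ 2 <= M (j - 1)%nat * M (j + 1)%nat) /\
  is_lim_seq (fun k => Rpower (M k) (/ INR k)) p_infty.

(* A function [I -> C] is represented by [f : R -> C]; the notions below only
   depend on the values of [f] on [I], and functions are compared on [I]. *)

(* Coquelicot's [is_derive] with [locally x] replaced by its trace on [I]: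
   the derivative is one-sided at the boundary points of [I]. *)
Definition is_derive_on (I : R -> Prop) (f : R -> C) (x : R) (l : C) : Prop :=
  @filterdiff R_AbsRing R_NormedModule C_R_NormedModule
    f (within I (locally x)) (fun y => @scal R_AbsRing C_R_NormedModule y l).

Definition ex_derive_on (I : R -> Prop) (f : R -> C) (x : R) : Prop :=
  exists l : C, is_derive_on I f x l.

(* [iota] picks the derivative when it exists: it is unique at a point [x] of
   an interval [I] with more than one point. *)
Definition Derive_on (I : R -> Prop) (f : R -> C) (x : R) : C :=
  @iota C_R_CompleteNormedModule (is_derive_on I f x).

Fixpoint Derive_n_on (I : R -> Prop) (f : R -> C) (n : nat) : R -> C :=
  match n with
  | O => f
  | S m => Derive_on I (Derive_n_on I f m)
  end.

Definition smooth_on (I : R -> Prop) (f : R -> C) : Prop :=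
  forall n x, I x -> ex_derive_on I (Derive_n_on I f n) x.

Definition supp (I : R -> Prop) (f : R -> C) : R -> Prop :=
  adherence (fun x => I x /\ f x <> 0%C).

Definition line : R -> Prop := fun _ => True.
Definition half_line : R -> Prop := fun x => 0 <= x.
Definition segment (a b : R) : R -> Prop := fun x => a <= x <= b.

Inductive growth_type : Set := Roumieu | Beurling.

Definition growth_bound (I : R -> Prop) (r : nat) (M : nat -> R)
    (f : R -> C) (h : R) : Prop :=
  exists B : R, forall n x, I x ->
    Cmod (Derive_n_on I f (r * n) x) / (h ^ n * M n) <= B.

Definition has_growth (t : growth_type) (I : R -> Prop) (r : nat)
    (M : nat -> R) (f : R -> C) : Prop :=
  match t with
  | Roumieu => exists h, 0 < h /\ growth_bound I r M f h
  | Beurling => forall h, 0 < h -> growth_bound I r M f h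
  end.

Definition ramified_class (t : growth_type) (I : R -> Prop) (r : nat)
    (M : nat -> R) (f : R -> C) : Prop :=
  smooth_on I f /\
  (forall n j, (1 <= j < r)%nat -> Derive_n_on I f (r * n + j) 0 = 0%C) /\
  has_growth t I r M f.

Definition class_D (t : growth_type) (r : nat) (M : nat -> R) (f : R -> C) :=
  ramified_class t line r M f /\ included (supp line f) (segment (-1) 1).

Definition class_L (t : growth_type) (r : nat) (M : nat -> R) (f : R -> C) :=
  ramified_class t half_line r M f /\
  included (supp half_line f) (segment 0 1).

Definition class_N (t : growth_type) (r : nat) (M : nat -> R) (f : R -> C) :=
  ramified_class t half_line r M f.

Definition class_E (t : growth_type) (r : nat) (M : nat -> R) (f : R -> C) :=
  ramified_class t (segment 0 1) r M f.

Definition Borel (I : R -> Prop) (x : R) (f : R -> C) : nat -> C :=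
  fun k => Derive_n_on I f k x.

Definition Borel_injective (I : R -> Prop) (x : R) (A : (R -> C) -> Prop) :=
  forall f g, A f -> A g -> (forall k, Borel I x f k = Borel I x g k) ->
  forall y, I y -> f y = g y.

Definition quasianalytic (I : R -> Prop) (A : (R -> C) -> Prop) : Prop :=
  forall x, I x -> Borel_injective I x A.

Definition nonquasianalytic (I : R -> Prop) (A : (R -> C) -> Prop) : Prop :=
  ~ quasianalytic I A.

(* Main.v *)
Require Import Defs.
From Stdlib Require Import Reals Lra Lia Classical.
From Coquelicot Require Import Coquelicot.
Open Scope R_scope.

(* If the series diverges, Bang's argument applies to the difference of two
   class members with equal Borel images, using only the bounds on derivatives
   of order [r * n].  Put [rho_m = (h * mu_(m+1))^(1/r)] and
   [P_k = prod_(i < k) rho_(i/r)], so that [P_(r n) = h^n M_n].  If at some point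
   [|f^(k)| <= A P_k exp (k - r (m+1))] for all [k < r (m+1)], then integrating
   down from the global bound on [f^(r (m+1))] shows that the exponent grows at
   rate at most [e * rho_m], so that [|f^(k)| <= A P_k exp (k - r m)] still holds
   at distance [r / (e rho_m)].  Chaining these steps from a flat point, with [m]
   descending from [K] to [m0], covers any distance as [K] grows, because
   [sum 1 / rho_m] diverges; hence [|f| <= A exp (- r m0)] for every [m0].

   If the series converges, an infinite convolution of normalized indicator
   functions of [[- a_k, a_k]] gives a bump supported in [[1/4, 3/4]] whose
   [k]-th derivative is bounded by [1 / (a_0 ... a_(k-1))].  Taking [a_k]
   proportional to [mu_(i+1)^(-1/r) / sqrt R_i], where [i = k / r] and [R_i] is
   the tail of the series, gives the Beurling bounds because [R_i] tends to 0. *)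

(** * Derivatives within a set *)

(** Written without a quotient, so that [y = x] needs no exclusion and one-sided derivatives at
    endpoints are included. *)
Definition derive_within (I : R -> Prop) (u : R -> R) (x l : R) : Prop :=
  forall eps, 0 < eps -> exists delta, 0 < delta /\
    forall y, I y -> Rabs (y - x) < delta ->
      Rabs (u y - u x - l * (y - x)) <= eps * Rabs (y - x).

Definition no_isolated_point (I : R -> Prop) : Prop :=
  forall x, I x -> forall delta, 0 < delta ->
    exists y, I y /\ y <> x /\ Rabs (y - x) < delta.

Definition convex (I : R -> Prop) : Prop :=
  forall x y z, I x -> I y -> x <= z <= y -> I z.

(** A step of length at most [1 / 2], to the right if [x <= 1 / 2] and to the left otherwise, stays
    between [x] and one of the points [0], [1] of [I]. *)
Lemma convex_no_isolated_point (I : R -> Prop) :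
  convex I -> I 0 -> I 1 -> no_isolated_point I.
Proof.
  intros HI H0 H1 x Hx d Hd.
  set (e := Rmin (1 / 2) (d / 2)).
  assert (He : 0 < e /\ e <= 1 / 2 /\ e <= d / 2).
  { unfold e. repeat split; [apply Rmin_pos; lra | apply Rmin_l | apply Rmin_r]. }
  destruct (Rle_dec x (1 / 2)).
  - exists (x + e). repeat split; [apply (HI x 1); auto; lra | lra |].
    rewrite Rabs_pos_eq; lra.
  - exists (x - e). repeat split; [apply (HI 0 x); auto; lra | lra |].
    rewrite Rabs_left1; lra.
Qed.

Lemma derive_within_unique (I : R -> Prop) (u : R -> R) (x l1 l2 : R) :
  no_isolated_point I -> I x ->
  derive_within I u x l1 -> derive_within I u x l2 -> l1 = l2.
Proof.
  intros HI Hx H1 H2.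
  destruct (Req_dec l1 l2) as [E | E]; [exact E | exfalso].
  assert (Hp : 0 < Rabs (l1 - l2)) by (apply Rabs_pos_lt; lra).
  destruct (H1 (Rabs (l1 - l2) / 4)) as (d1 & Hd1 & K1); [lra |].
  destruct (H2 (Rabs (l1 - l2) / 4)) as (d2 & Hd2 & K2); [lra |].
  destruct (HI x Hx (Rmin d1 d2)) as (y & Hy & Hyx & Hd).
  { now apply Rmin_pos. }
  specialize (K1 y Hy (Rlt_le_trans _ _ _ Hd (Rmin_l _ _))).
  specialize (K2 y Hy (Rlt_le_trans _ _ _ Hd (Rmin_r _ _))).
  assert (Hq : 0 < Rabs (y - x)) by (apply Rabs_pos_lt; lra).
  assert (Rabs (l1 - l2) * Rabs (y - x) <= Rabs (l1 - l2) / 2 * Rabs (y - x)).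
  { rewrite <- Rabs_mult.
    replace ((l1 - l2) * (y - x)) with
      ((u y - u x - l2 * (y - x)) - (u y - u x - l1 * (y - x))) by ring.
    eapply Rle_trans; [apply Rabs_triang |]. rewrite Rabs_Ropp. lra. }
  nra.
Qed.

Lemma derive_within_subset (I J : R -> Prop) (u : R -> R) (x l : R) :
  (forall y, J y -> I y) -> derive_within I u x l -> derive_within J u x l.
Proof.
  intros HJ H eps He. destruct (H eps He) as (d & Hd & K).
  exists d. split; auto.
Qed.

Lemma derive_within_plus (I : R -> Prop) (u v : R -> R) (x l m : R) :
  derive_within I u x l -> derive_within I v x m ->
  derive_within I (fun y => u y + v y) x (l + m).
Proof.
  intros Hu Hv eps He.
  destruct (Hu (eps / 2)) as (d1 & Hd1 & K1); [lra |].
  destruct (Hv (eps / 2)) as (d2 & Hd2 & K2); [lra |].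
  exists (Rmin d1 d2). split; [now apply Rmin_pos |].
  intros y Hy Hd.
  specialize (K1 y Hy (Rlt_le_trans _ _ _ Hd (Rmin_l _ _))).
  specialize (K2 y Hy (Rlt_le_trans _ _ _ Hd (Rmin_r _ _))).
  replace (u y + v y - (u x + v x) - (l + m) * (y - x)) with
    ((u y - u x - l * (y - x)) + (v y - v x - m * (y - x))) by ring.
  eapply Rle_trans; [apply Rabs_triang |]. lra.
Qed.

Lemma derive_within_scal (I : R -> Prop) (u : R -> R) (c x l : R) :
  derive_within I u x l -> derive_within I (fun y => c * u y) x (c * l).
Proof.
  intros Hu eps He.
  pose proof (Rabs_pos c) as Hc.
  destruct (Hu (eps / (Rabs c + 1))) as (d & Hd & K).
  { apply Rdiv_lt_0_compat; lra. }
  exists d. split; [exact Hd |]. intros y Hy Hyd.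
  specialize (K y Hy Hyd).
  replace (c * u y - c * u x - c * l * (y - x)) with
    (c * (u y - u x - l * (y - x))) by ring.
  rewrite Rabs_mult.
  apply Rle_trans with ((Rabs c + 1) * (eps / (Rabs c + 1) * Rabs (y - x))).
  - apply Rmult_le_compat; auto using Rabs_pos; lra.
  - right. field. lra.
Qed.

(** With [s = 1] or [s = -1] this moves a flat point to [0] and turns either direction into the
    positive one. *)
Lemma derive_within_affine (I J : R -> Prop) (u : R -> R) (a s x l : R) :
  Rabs s = 1 -> (forall y, J y -> I (a + s * y)) ->
  derive_within I u (a + s * x) l ->
  derive_within J (fun y => u (a + s * y)) x (s * l).
Proof.
  intros Hs HJ H eps He. destruct (H eps He) as (d & Hd & K).
  exists d. split; [exact Hd |]. intros y Hy Hyd.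
  assert (E : Rabs (a + s * y - (a + s * x)) = Rabs (y - x)).
  { replace (a + s * y - (a + s * x)) with (s * (y - x)) by ring.
    rewrite Rabs_mult, Hs. ring. }
  specialize (K (a + s * y) (HJ y Hy)). rewrite E in K.
  specialize (K Hyd).
  replace (s * l * (y - x)) with (l * (a + s * y - (a + s * x))) by ring.
  exact K.
Qed.

(** * Translating filter-based real and complex derivatives into estimates *)

Lemma is_derive_derive_within (I : R -> Prop) (u : R -> R) (x l : R) :
  is_derive u x l -> derive_within I u x l.
Proof.
  intros [_ H] eps He.
  destruct (H x (fun P HP => HP) (mkposreal eps He)) as (d & K).
  exists d. split; [apply cond_pos |]. intros y _ Hy.
  specialize (K y Hy). unfold norm, minus, scal, plus, opp in K; simpl in K.
  unfold abs, mult in K; simpl in K.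
  replace (u y - u x - l * (y - x)) with
    (u y + - u x + - ((y + - x) * l)) by ring.
  exact K.
Qed.

(** [filterdiff] quantifies over all limits of its filter; since the line is separated and [x] lies
    in [I], the only limit is [x]. *)
Lemma within_filter_lim (I : R -> Prop) (x y : R) :
  I x -> is_filter_lim (within I (locally x)) y -> y = x.
Proof.
  intros Hx H.
  destruct (Req_dec y x) as [E | E]; [exact E | exfalso].
  assert (Hp : 0 < Rabs (x - y)) by (apply Rabs_pos_lt; lra).
  assert (K : locally y (fun z => Rabs (z - y) < Rabs (x - y))).
  { exists (mkposreal _ Hp). intros z Hz. exact Hz. }
  apply H in K. apply locally_singleton in K.
  specialize (K Hx). lra.
Qed.

Lemma C_R_norm (z : C) : @norm R_AbsRing C_R_NormedModule z = Cmod z.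
Proof.
  unfold norm; simpl. unfold prod_norm, Cmod, norm; simpl. unfold abs; simpl.
  f_equal. rewrite !Rmult_1_r, <- !Rabs_mult.
  rewrite !Rabs_pos_eq; auto; apply Rle_0_sqr.
Qed.

Lemma is_derive_on_Cmod (I : R -> Prop) (f : R -> C) (x : R) (l : C) :
  I x ->
  is_derive_on I f x l <->
  forall eps, 0 < eps -> exists delta, 0 < delta /\
    forall y, I y -> Rabs (y - x) < delta ->
      Cmod (f y - f x - RtoC (y - x) * l)%C <= eps * Rabs (y - x).
Proof.
  intros Hx.
  assert (E : forall y, @minus C_R_NormedModule
      (@minus C_R_NormedModule (f y) (f x))
      (@scal R_AbsRing C_R_NormedModule (@minus R_NormedModule y x) l) =
      (f y - f x - RtoC (y - x) * l)%C).
  { intros y. destruct (f y) as [a b], (f x) as [c d], l as [p q].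
    apply injective_projections.
    - change (a + - c + - ((y + - x) * p)
        = a + - c + - ((y - x) * p - 0 * q)). ring.
    - change (b + - d + - ((y + - x) * q)
        = b + - d + - ((y - x) * q + 0 * p)). ring. }
  split.
  - intros [_ H] eps He.
    assert (L : is_filter_lim (within I (locally x)) x).
    { intros P HP. apply filter_le_within. exact HP. }
    destruct (H x L (mkposreal eps He)) as (d & K).
    exists d. split; [apply cond_pos |]. intros y Hy Hd.
    specialize (K y Hd Hy). rewrite C_R_norm, E in K. exact K.
  - intros H. split; [apply is_linear_scal_l |].
    intros y Hy eps. apply within_filter_lim in Hy; [subst y | exact Hx].
    destruct (H eps (cond_pos eps)) as (d & Hd & K).
    exists (mkposreal d Hd). intros y Hy HI.
    rewrite C_R_norm, E. exact (K y HI Hy).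
Qed.

Lemma is_derive_on_Re (I : R -> Prop) (f : R -> C) (x : R) (l : C) :
  I x -> is_derive_on I f x l -> derive_within I (fun y => Re (f y)) x (Re l).
Proof.
  intros Hx H eps He.
  destruct (proj1 (is_derive_on_Cmod I f x l Hx) H eps He) as (d & Hd & K).
  exists d. split; [exact Hd |]. intros y Hy Hyd.
  refine (Rle_trans _ _ _ _ (K y Hy Hyd)).
  refine (Rle_trans _ _ _ _ (Rle_trans _ _ _ (Rmax_l _ _) (Rmax_Cmod _))).
  right. f_equal. unfold Re; simpl. ring.
Qed.

Lemma is_derive_on_Im (I : R -> Prop) (f : R -> C) (x : R) (l : C) :
  I x -> is_derive_on I f x l -> derive_within I (fun y => Im (f y)) x (Im l).
Proof.
  intros Hx H eps He.
  destruct (proj1 (is_derive_on_Cmod I f x l Hx) H eps He) as (d & Hd & K).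
  exists d. split; [exact Hd |]. intros y Hy Hyd.
  refine (Rle_trans _ _ _ _ (K y Hy Hyd)).
  refine (Rle_trans _ _ _ _ (Rle_trans _ _ _ (Rmax_r _ _) (Rmax_Cmod _))).
  right. f_equal. unfold Im; simpl. ring.
Qed.

Lemma is_derive_on_RtoC (I : R -> Prop) (f : R -> C) (u : R -> R) (x l : R) :
  I x -> (forall y, I y -> f y = RtoC (u y)) ->
  derive_within I u x l -> is_derive_on I f x (RtoC l).
Proof.
  intros Hx Hf H. apply is_derive_on_Cmod; [exact Hx |].
  intros eps He. destruct (H eps He) as (d & Hd & K).
  exists d. split; [exact Hd |]. intros y Hy Hyd.
  rewrite !Hf; auto. rewrite <- RtoC_mult, <- !RtoC_minus, Cmod_R.
  rewrite (Rmult_comm (y - x)). auto.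
Qed.

Lemma is_derive_on_unique (I : R -> Prop) (f : R -> C) (x : R) (l1 l2 : C) :
  no_isolated_point I -> I x ->
  is_derive_on I f x l1 -> is_derive_on I f x l2 -> l1 = l2.
Proof.
  intros HI Hx H1 H2.
  apply injective_projections.
  - refine (derive_within_unique I _ x _ _ HI Hx (is_derive_on_Re _ _ _ _ Hx H1)
      (is_derive_on_Re _ _ _ _ Hx H2)).
  - refine (derive_within_unique I _ x _ _ HI Hx (is_derive_on_Im _ _ _ _ Hx H1)
      (is_derive_on_Im _ _ _ _ Hx H2)).
Qed.

Lemma Derive_on_unique (I : R -> Prop) (f : R -> C) (x : R) (l : C) :
  no_isolated_point I -> I x -> is_derive_on I f x l -> Derive_on I f x = l.
Proof.
  intros HI Hx H. unfold Derive_on.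
  apply (@iota_unique _ C_R_CompleteNormedModule (is_derive_on I f x));
    [| exact H].
  intros y Hy. exact (is_derive_on_unique I f x y l HI Hx Hy H).
Qed.

Lemma smooth_on_is_derive (I : R -> Prop) (f : R -> C) (n : nat) (x : R) :
  no_isolated_point I -> smooth_on I f -> I x ->
  is_derive_on I (Derive_n_on I f n) x (Derive_n_on I f (S n) x).
Proof.
  intros HI Hf Hx. destruct (Hf n x Hx) as [l Hl].
  simpl. rewrite (Derive_on_unique I _ x l HI Hx Hl). exact Hl.
Qed.

(** The sequence [g] lists explicit candidates for the successive derivatives; uniqueness within [I]
    forces [Derive_n_on] to agree with them there. *)
Lemma Derive_n_on_RtoC (I : R -> Prop) (g : nat -> R -> R) (k : nat) (x : R) :
  no_isolated_point I ->
  (forall n y, I y -> derive_within I (g n) y (g (S n) y)) ->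
  I x -> Derive_n_on I (fun y => RtoC (g 0%nat y)) k x = RtoC (g k x).
Proof.
  intros HI Hg. revert x. induction k as [| k IH]; intros x Hx; [reflexivity |].
  simpl. apply Derive_on_unique; auto.
  apply is_derive_on_RtoC with (u := g k); auto.
Qed.

Lemma smooth_on_RtoC (I : R -> Prop) (g : nat -> R -> R) :
  no_isolated_point I ->
  (forall n y, I y -> derive_within I (g n) y (g (S n) y)) ->
  smooth_on I (fun y => RtoC (g 0%nat y)).
Proof.
  intros HI Hg n x Hx. exists (RtoC (g (S n) x)).
  apply is_derive_on_RtoC with (u := g n); auto.
  intros y Hy. now apply Derive_n_on_RtoC.
Qed.

(** * Monotonicity and the mean value inequality on a segment *)

Lemma derive_within_le (a b : R) (w dw : R -> R) :
  a <= b ->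
  (forall x, a <= x <= b ->
    derive_within (fun y => a <= y <= b) w x (dw x) /\ 0 <= dw x) ->
  w a <= w b.
Proof.
  intros Hab H. destruct Hab as [Hab | Hab]; [| subst; apply Rle_refl].
  (* [MVT_gen] needs continuity at the endpoints from both sides: extend [w]
     by constants outside [a, b]. *)
  set (p := fun y => Rmax a (Rmin b y)).
  assert (Hp : forall y, a <= p y <= b).
  { intros y. unfold p. split; [apply Rmax_l |].
    apply Rmax_lub; [lra | apply Rmin_l]. }
  assert (Hid : forall y, a <= y <= b -> p y = y).
  { intros y Hy. unfold p. rewrite Rmin_right, Rmax_right; lra. }
  assert (Hlip : forall x y, a <= x <= b -> Rabs (p y - x) <= Rabs (y - x)).
  { intros x y Hx. unfold p, Rmax, Rmin.
    destruct (Rle_dec b y); destruct (Rle_dec a _);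
      unfold Rabs; repeat destruct Rcase_abs; lra. }
  destruct (MVT_gen (fun y => w (p y)) a b dw) as (c & Hc & E).
  - intros x Hx. rewrite Rmin_left, Rmax_right in Hx by lra.
    apply is_derive_Reals. intros eps He.
    destruct (proj1 (H x ltac:(lra)) (eps / 2)) as (d & Hd & K); [lra |].
    assert (He' : 0 < Rmin d (Rmin (x - a) (b - x))).
    { repeat apply Rmin_pos; lra. }
    exists (mkposreal _ He'). intros h Hh Hlt. simpl in Hlt.
    pose proof (Rmin_l d (Rmin (x - a) (b - x))).
    pose proof (Rmin_r d (Rmin (x - a) (b - x))).
    pose proof (Rmin_l (x - a) (b - x)). pose proof (Rmin_r (x - a) (b - x)).
    assert (Hxh : a <= x + h <= b) by (apply Rabs_def2 in Hlt; lra).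
    rewrite !Hid by lra.
    specialize (K (x + h) Hxh). replace (x + h - x) with h in K by ring.
    specialize (K ltac:(lra)).
    assert (0 < Rabs h) by now apply Rabs_pos_lt.
    replace ((w (x + h) - w x) / h - dw x)
      with ((w (x + h) - w x - dw x * h) / h) by (field; auto).
    rewrite Rabs_div by auto. apply Rlt_div_l; [lra |]. nra.
  - intros x Hx. rewrite Rmin_left, Rmax_right in Hx by lra.
    destruct (proj1 (H x Hx) 1 ltac:(lra)) as (d & Hd & K).
    intros eps He.
    pose proof (Rabs_pos (dw x)) as Hdw.
    exists (Rmin d (eps / (Rabs (dw x) + 2))). split.
    { apply Rmin_pos; [lra |]. apply Rdiv_lt_0_compat; lra. }
    intros y [_ Hy]. simpl in Hy |- *. unfold Rdist in *.
    rewrite (Hid x Hx).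
    pose proof (Hlip x y Hx) as Hl.
    specialize (K (p y) (Hp y)
      (Rle_lt_trans _ _ _ Hl (Rlt_le_trans _ _ _ Hy (Rmin_l _ _)))).
    assert (Hy' := Rlt_le_trans _ _ _ Hy (Rmin_r _ _)).
    apply Rlt_div_r in Hy'; [| lra].
    replace (w (p y) - w x) with
      ((w (p y) - w x - dw x * (p y - x)) + dw x * (p y - x)) by ring.
    eapply Rle_lt_trans; [apply Rabs_triang |]. rewrite Rabs_mult.
    pose proof (Rabs_pos (y - x)). pose proof (Rabs_pos (p y - x)). nra.
  - rewrite Rmin_left, Rmax_right in Hc by lra.
    rewrite !Hid in E by lra. pose proof (proj2 (H c Hc)). nra.
Qed.

(** Both [G - v] and [G + v] have nonnegative derivative, hence do not decrease from [a] to [b]. *)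
Lemma derive_within_abs_le (a b : R) (v dv G dG : R -> R) :
  a <= b ->
  (forall x, a <= x <= b -> derive_within (fun y => a <= y <= b) v x (dv x)) ->
  (forall x, a <= x <= b -> derive_within (fun y => a <= y <= b) G x (dG x)) ->
  (forall x, a <= x <= b -> Rabs (dv x) <= dG x) ->
  Rabs (v a) <= G a -> Rabs (v b) <= G b.
Proof.
  intros Hab Hv HG Hd Ha.
  assert (K1 : G a + -1 * v a <= G b + -1 * v b).
  { apply (derive_within_le a b (fun y => G y + -1 * v y)
      (fun y => dG y + -1 * dv y) Hab).
    intros x Hx. split.
    - apply derive_within_plus; auto. now apply derive_within_scal, Hv.
    - pose proof (Hd x Hx) as K. apply Rabs_le_between in K. lra. }
  assert (K2 : G a + v a <= G b + v b).
  { apply (derive_within_le a b (fun y => G y + v y) (fun y => dG y + dv y) Hab).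
    intros x Hx. split.
    - apply derive_within_plus; auto.
    - pose proof (Hd x Hx) as K. apply Rabs_le_between in K. lra. }
  apply Rabs_le_between in Ha. apply Rabs_le_between. lra.
Qed.

(** * Bang's theorem *)

Fixpoint prodR (a : nat -> R) (n : nat) : R :=
  match n with
  | O => 1
  | S m => prodR a m * a m
  end.

Lemma prodR_pos (a : nat -> R) (n : nat) :
  (forall k, 0 < a k) -> 0 < prodR a n.
Proof.
  intros Ha. induction n; simpl; [lra | now apply Rmult_lt_0_compat].
Qed.

Lemma prodR_ext (a b : nat -> R) (n : nat) :
  (forall k, a k = b k) -> prodR a n = prodR b n.
Proof. intros H. induction n; simpl; congruence. Qed.

Lemma prodR_inv (a : nat -> R) (n : nat) :
  prodR (fun k => / a k) n = / prodR a n.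
Proof.
  induction n; simpl; [now rewrite Rinv_1 | now rewrite IHn, Rinv_mult].
Qed.

Lemma prodR_mult (a b : nat -> R) (n : nat) :
  prodR (fun k => a k * b k) n = prodR a n * prodR b n.
Proof. induction n; simpl; [ring | rewrite IHn; ring]. Qed.

Lemma block_index (r n j : nat) : (j < r)%nat -> ((r * n + j) / r = n)%nat.
Proof. intros Hj. symmetry. now apply (Nat.div_unique _ _ n j). Qed.

(** The quotient [k / r] is constant on each block of [r] consecutive indices, so block [i]
    contributes [d i ^ r]. *)
Lemma prodR_blocks (d : nat -> R) (r n : nat) :
  prodR (fun k => d (k / r)%nat) (r * n) = prodR (fun i => d i ^ r) n.
Proof.
  induction n as [| n IH]; [now rewrite Nat.mul_0_r |].
  simpl. rewrite <- IH.
  assert (K : forall j, (j <= r)%nat ->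
    prodR (fun k => d (k / r)%nat) (r * n + j) =
    prodR (fun k => d (k / r)%nat) (r * n) * d n ^ j).
  { induction j as [| j IHj]; intros Hj; [rewrite Nat.add_0_r; simpl; ring |].
    rewrite Nat.add_succ_r. simpl. rewrite IHj, block_index by lia. ring. }
  replace (r * S n)%nat with (r * n + r)%nat by lia. now apply K.
Qed.

(* The majorant of [v k] is [C * nu 0 * ... * nu (k - 1) * exp (k + exp 1 * q * x)]:
   since [nu k <= q], its derivative dominates the majorant of [v (S k)]. *)
Lemma bang_growth (a b A q : R) (m : nat) (v : nat -> R -> R) (nu : nat -> R) :
  0 <= A -> 0 < q -> (forall k, 0 < nu k) ->
  (forall k, (k < m)%nat -> nu k <= q) ->
  (forall k x, a <= x <= b ->
    derive_within (fun y => a <= y <= b) (v k) x (v (S k) x)) ->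
  (forall x, a <= x <= b -> Rabs (v m x) <= A * prodR nu m) ->
  (forall k, (k < m)%nat ->
    Rabs (v k a) <= A * prodR nu k * exp (INR k - INR m)) ->
  forall k x, (k <= m)%nat -> a <= x <= b ->
    Rabs (v k x) <= A * prodR nu k * exp (INR k - INR m + exp 1 * q * (x - a)).
Proof.
  intros HA Hq Hnu Hnuq Hder Hm Ha.
  (* Downward induction on [k], with [d = m - k]: the bound on [v (S k)] is integrated from [a] to
     bound [v k]. *)
  assert (K : forall d k x, (k + d = m)%nat -> a <= x <= b ->
    Rabs (v k x) <= A * prodR nu k * exp (INR k - INR m + exp 1 * q * (x - a))).
  2: { intros k x Hk Hx. apply (K (m - k)%nat); [lia | exact Hx]. }
  pose proof (exp_pos 1) as He.
  induction d as [| d IH]; intros k x Hk Hx.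
  - replace m with k in * by lia.
    pose proof (Hm x Hx) as K. pose proof (prodR_pos nu k Hnu) as Hp.
    assert (1 <= exp (INR k - INR k + exp 1 * q * (x - a))).
    { replace (INR k - INR k + exp 1 * q * (x - a))
        with (exp 1 * q * (x - a)) by ring.
      assert (0 <= exp 1 * q * (x - a)).
      { apply Rmult_le_pos; [| lra]. apply Rmult_le_pos; lra. }
      pose proof (exp_ineq1_le (exp 1 * q * (x - a))). lra. }
    assert (0 <= A * prodR nu k) by (apply Rmult_le_pos; lra). nra.
  - assert (Hkm : (k < m)%nat) by lia.
    apply (derive_within_abs_le a x (v k) (v (S k))
      (fun y => A * prodR nu k * exp (INR k - INR m + exp 1 * q * (y - a)))
      (fun y => A * prodR nu k *
        (exp 1 * q * exp (INR k - INR m + exp 1 * q * (y - a)))));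
      try lra.
    + intros y Hy. apply derive_within_subset with (fun y => a <= y <= b).
      * intros z Hz; lra.
      * apply Hder; lra.
    + intros y Hy. apply is_derive_derive_within. auto_derive; [easy | unfold Rminus; ring].
    + intros y Hy. eapply Rle_trans; [apply (IH (S k)); [lia | lra] |].
      simpl prodR. rewrite S_INR.
      replace (INR k + 1 - INR m + exp 1 * q * (y - a))
        with (1 + (INR k - INR m + exp 1 * q * (y - a))) by ring.
      rewrite (exp_plus 1).
      pose proof (exp_pos (INR k - INR m + exp 1 * q * (y - a))) as HE.
      pose proof (prodR_pos nu k Hnu) as Hp.
      pose proof (Hnuq k Hkm) as Hkq.
      replace (A * prodR nu k *
          (exp 1 * q * exp (INR k - INR m + exp 1 * q * (y - a)))) with
        (A * (prodR nu k * q) *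
          (exp 1 * exp (INR k - INR m + exp 1 * q * (y - a)))) by ring.
      apply Rmult_le_compat_r; [nra |].
      apply Rmult_le_compat_l; [lra |].
      apply Rmult_le_compat_l; lra.
    + replace (INR k - INR m + exp 1 * q * (a - a))
        with (INR k - INR m) by ring. auto.
Qed.

Lemma bang_quasianalytic (r : nat) (b A : R) (v : nat -> R -> R)
    (rho : nat -> R) :
  (1 <= r)%nat -> 0 <= A ->
  (forall n, 0 < rho n) -> (forall n, rho n <= rho (S n)) ->
  (forall m T, exists K, T <= sum_n_m (fun i => / rho i) m K) ->
  (forall k x, 0 <= x <= b ->
    derive_within (fun y => 0 <= y <= b) (v k) x (v (S k) x)) ->
  (forall n x, 0 <= x <= b ->
    Rabs (v (r * n)%nat x) <= A * prodR (fun k => rho (k / r)%nat) (r * n)) ->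
  (forall k, v k 0 = 0) ->
  forall x, 0 <= x <= b -> v 0%nat x = 0.
Proof.
  intros Hr HA Hpos Hmon Hdiv Hder Hgr H0 x Hx.
  pose proof (exp_pos 1) as He.
  assert (Hr' : 0 < INR r) by (apply lt_0_INR; lia).
  assert (Hinc : forall i j, (i <= j)%nat -> rho i <= rho j).
  { induction 1; [apply Rle_refl | eapply Rle_trans; eauto]. }
  set (P := prodR (fun k => rho (k / r)%nat)) in *.
  assert (HP : forall k, 0 < P k) by (intros k; now apply prodR_pos).
  (* Chain of steps by induction on [j = K + 1 - m]. For [m = K + 1] the sum is empty, so [y] is the
     flat point [0]. *)
  assert (Hstep : forall K j m y, (m + j = S K)%nat -> 0 <= y <= b ->
    y <= INR r / exp 1 * sum_n_m (fun i => / rho i) m K ->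
    forall k, (k < r * S m)%nat ->
      Rabs (v k y) <= A * P k * exp (INR k - INR (r * m))).
  { intros K. induction j as [| j IH]; intros m y Hm Hy Hsum k Hk.
    - rewrite sum_n_m_zero in Hsum by lia.
      unfold zero in Hsum; simpl in Hsum.
      replace y with 0 by lra. rewrite H0, Rabs_R0.
      apply Rmult_le_pos; [| apply Rlt_le, exp_pos].
      apply Rmult_le_pos; [exact HA | now apply Rlt_le].
    - rewrite sum_Sn_m in Hsum by lia. unfold plus in Hsum; simpl in Hsum.
      set (S' := sum_n_m (fun i => / rho i) (S m) K) in *.
      assert (HS : 0 <= S').
      { apply Rle_trans with (sum_n_m (fun _ => 0) (S m) K).
        - rewrite sum_n_m_const. lra.
        - apply sum_n_m_le. intros i. now apply Rlt_le, Rinv_0_lt_compat. }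
      (* [z] is the part of the way to [y] that the levels above [m] can cover; the rest is at most
         one step [r / (e rho_m)] of level [m]. *)
      set (z := Rmin y (INR r / exp 1 * S')).
      assert (Hre : 0 < INR r / exp 1) by now apply Rdiv_lt_0_compat.
      assert (Hz : 0 <= z <= y).
      { unfold z. split; [apply Rmin_glb; nra | apply Rmin_l]. }
      assert (Hyz : y - z <= INR r / exp 1 * / rho m).
      { unfold z, Rmin. destruct Rle_dec; [| lra].
        pose proof (Rinv_0_lt_compat _ (Hpos m)). nra. }
      pose proof (bang_growth z y A (rho m) (r * S m) v
        (fun k => rho (k / r)%nat) HA (Hpos m)) as B.
      fold P in B.
      eapply Rle_trans; [apply B with (k := k) (x := y) |].
      + intros i; apply Hpos.
      + intros i Hi. apply Hinc. apply Nat.lt_succ_r.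
        apply Nat.Div0.div_lt_upper_bound. exact Hi.
      + intros i s Hs. apply derive_within_subset with (fun y => 0 <= y <= b).
        * intros w Hw; lra.
        * apply Hder; lra.
      + intros s Hs. apply Hgr; lra.
      + intros i Hi. apply (IH (S m) z); try lra; try lia.
        apply Rmin_r.
      + lia.
      + lra.
      + apply Rmult_le_compat_l.
        * apply Rmult_le_pos; [exact HA | now apply Rlt_le].
        (* The exponent grows by at most [r], which is exactly the difference between [r (m + 1)]
           and [r m]. *)
        * assert (L : exp 1 * rho m * (y - z) <= INR r).
          { apply Rle_trans with (exp 1 * rho m * (INR r / exp 1 * / rho m)).
            - apply Rmult_le_compat_l; [| exact Hyz].
              apply Rmult_le_pos; [lra | now apply Rlt_le].
            - right. field. split; [apply Rgt_not_eq, Hpos | lra]. }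
          assert (L2 : INR k - INR (r * S m) + exp 1 * rho m * (y - z)
              <= INR k - INR (r * m)).
          { rewrite !mult_INR, S_INR. lra. }
          destruct L2 as [L2 | L2].
          -- now apply Rlt_le, exp_increasing.
          -- rewrite L2. apply Rle_refl. }
  (* The bound [exp (- r m)] is weakened to [1 / (1 + m)], which suffices to let [m] tend to
     infinity. *)
  assert (Hall : forall m, Rabs (v 0%nat x) <= A * / (1 + INR m)).
  { intros m. destruct (Hdiv m (b / (INR r / exp 1))) as [K HK].
    assert (Hre : 0 < INR r / exp 1) by now apply Rdiv_lt_0_compat.
    apply Rle_div_l in HK; [| exact Hre].
    destruct (Nat.le_gt_cases m (S K)) as [Hm | Hm].
    - assert (HH := Hstep K (S K - m)%nat m x ltac:(lia) Hx ltac:(lra)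
        0%nat ltac:(lia)).
      eapply Rle_trans; [exact HH |]. unfold P; simpl.
      rewrite Rmult_1_r. apply Rmult_le_compat_l; [exact HA |].
      replace (0 - INR (r * m)) with (- INR (r * m)) by ring.
      rewrite exp_Ropp. pose proof (pos_INR m).
      apply Rinv_le_contravar; [lra |].
      eapply Rle_trans; [| apply exp_ineq1_le].
      apply Rplus_le_compat_l, le_INR. nia.
    (* An empty sum can reach length [b] only if [b = 0], and then [x] is the flat point. *)
    - rewrite sum_n_m_zero in HK by lia. unfold zero in HK; simpl in HK.
      assert (E : x = 0) by lra. rewrite E, H0, Rabs_R0.
      pose proof (pos_INR m).
      apply Rmult_le_pos; [exact HA |]. apply Rlt_le, Rinv_0_lt_compat. lra. }
  destruct (Req_dec (v 0%nat x) 0) as [E | E]; [exact E | exfalso].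
  assert (Hv : 0 < Rabs (v 0%nat x)) by now apply Rabs_pos_lt.
  destruct (INR_unbounded (A / Rabs (v 0%nat x))) as [m Hm].
  specialize (Hall m). pose proof (pos_INR m).
  apply Rlt_div_l in Hm; [| lra].
  apply Rle_div_r in Hall; [| lra]. nra.
Qed.

(** * Quasianalyticity when the series diverges *)

Lemma mu_pos (M : nat -> R) (n : nat) : LC M -> 0 < mu M (S n).
Proof.
  intros (HM & _). unfold mu. now apply Rdiv_lt_0_compat.
Qed.

Lemma mu_le (M : nat -> R) (n : nat) : LC M -> mu M (S n) <= mu M (S (S n)).
Proof.
  intros (HM & _ & Hc & _). unfold mu. simpl.
  specialize (Hc (S n) ltac:(lia)). simpl in Hc.
  rewrite Nat.sub_0_r, Nat.add_1_r in *.
  pose proof (HM n). pose proof (HM (S n)).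
  apply Rle_div_l; [lra |].
  replace (M (S (S n)) / M (S n) * M n) with (M n * M (S (S n)) / M (S n))
    by (field; lra).
  apply Rle_div_r; nra.
Qed.

(** The quotients telescope, and [M 0 = 1]. *)
Lemma prodR_mu (M : nat -> R) (n : nat) :
  LC M -> prodR (fun i => mu M (S i)) n = M n.
Proof.
  intros (HM & [HM0 _] & _). induction n as [| n IH]; simpl; [now rewrite HM0 |].
  rewrite IH. unfold mu. simpl. rewrite Nat.sub_0_r. field.
  apply Rgt_not_eq, HM.
Qed.

Lemma Rpower_root (x : R) (r : nat) :
  (1 <= r)%nat -> 0 < x -> Rpower x (1 / INR r) ^ r = x.
Proof.
  intros Hr Hx. assert (0 < INR r) by (apply lt_0_INR; lia).
  rewrite <- Rpower_pow by apply exp_pos. rewrite Rpower_mult.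
  replace (1 / INR r * INR r) with 1 by (field; lra). now apply Rpower_1.
Qed.

(** With nonnegative terms, a bound on the sums starting at [m] would bound all partial sums and
    make the series converge. *)
Lemma not_ex_series_unbounded (t : nat -> R) :
  (forall n, 0 <= t n) -> ~ ex_series t ->
  forall m T, exists K, T <= sum_n_m t m K.
Proof.
  intros Ht Hs m T. apply NNPP. intros HT. apply Hs.
  assert (Hs' : ex_finite_lim_seq (sum_n t)).
  { assert (Hinc : forall n, sum_n t n <= sum_n t (S n)).
    { intros n. rewrite sum_Sn. unfold plus; simpl. pose proof (Ht (S n)). lra. }
    (* [Rmax T 0] replaces [T] so that the bound also covers the partial sums with [n <= m]. *)
    apply ex_finite_lim_seq_incr with (M := sum_n t m + Rmax T 0); [exact Hinc |].
    intros n. destruct (Nat.le_gt_cases n m) as [Hn | Hn].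
    - assert (sum_n t n <= sum_n t m).
      { clear HT. induction Hn; [apply Rle_refl |].
        exact (Rle_trans _ _ _ IHHn (Hinc _)). }
      pose proof (Rmax_r T 0). lra.
    - unfold sum_n. rewrite (sum_n_m_Chasles t 0 m n) by lia.
      unfold plus; simpl. apply Rplus_le_compat_l.
      apply Rle_trans with (sum_n_m t m n).
      + rewrite (sum_Sn_m t m n) by lia. unfold plus; simpl.
        pose proof (Ht m). lra.
      + destruct (Rle_dec (sum_n_m t m n) T) as [L | L].
        * eapply Rle_trans; [exact L | apply Rmax_l].
        * exfalso. apply HT. exists n. lra. }
  destruct Hs' as [l Hl]. exists l. exact Hl.
Qed.

(** Indexed from [0]: the term at [n] is the one for [p = n + 1]. *)
Definition root_series (M : nat -> R) (r : nat) : nat -> R :=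
  fun n => Rpower (1 / mu M (S n)) (1 / INR r).

Lemma flat_eq_0 (M : nat -> R) (r : nat) (I : R -> Prop) (u : nat -> R -> R)
    (A h x y : R) :
  LC M -> (1 <= r)%nat -> ~ ex_series (root_series M r) -> convex I ->
  0 < h -> 0 <= A ->
  (forall k z, I z -> derive_within I (u k) z (u (S k) z)) ->
  (forall n z, I z -> Rabs (u (r * n)%nat z) <= A * (h ^ n * M n)) ->
  I x -> I y -> (forall k, u k x = 0) -> u 0%nat y = 0.
Proof.
  intros HM Hr Hs HI Hh HA Hder Hgr Hx Hy Hflat.
  (* The segment from [x] to [y] is parametrized by [x + s * z] with [0 <= z <= b], whichever point
     is on the left. *)
  set (s := if Rle_dec x y then 1 else -1).
  assert (Hs1 : Rabs s = 1).
  { unfold s. destruct Rle_dec; [apply Rabs_R1 | rewrite Rabs_left; lra]. }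
  assert (Hss : s * s = 1) by (unfold s; destruct Rle_dec; ring).
  set (b := Rabs (y - x)).
  assert (Hsb : x + s * b = y).
  { unfold s, b. destruct Rle_dec; [rewrite Rabs_pos_eq | rewrite Rabs_left]; lra. }
  assert (Hb : 0 <= b) by apply Rabs_pos.
  assert (Hseg : forall z, 0 <= z <= b -> I (x + s * z)).
  { intros z Hz. unfold s in *. destruct Rle_dec.
    - apply (HI x y); auto; lra.
    - apply (HI y x); auto; lra. }
  (* The [r]-th power of [rho n] is [h * mu M (S n)], so the product of the first [r * n] block
     factors is [h ^ n * M n]. *)
  set (rho := fun n => Rpower (h * mu M (S n)) (1 / INR r)).
  assert (Hmu : forall n, 0 < h * mu M (S n)).
  { intros n. apply Rmult_lt_0_compat; [exact Hh | now apply mu_pos]. }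
  assert (Hr' : 0 < INR r) by (apply lt_0_INR; lia).
  assert (Hinvr : 0 < 1 / INR r) by (apply Rdiv_lt_0_compat; lra).
  assert (Hrho : forall n, / rho n = Rpower (/ h) (1 / INR r) * root_series M r n).
  { intros n. unfold rho, root_series. pose proof (mu_pos M n HM).
    rewrite Rpower_mult_distr.
    - rewrite <- Rpower_Ropp. unfold Rpower. f_equal.
      replace (/ h * (1 / mu M (S n))) with (/ (h * mu M (S n))) by (field; lra).
      rewrite ln_Rinv by auto. ring.
    - now apply Rinv_0_lt_compat.
    - apply Rdiv_lt_0_compat; lra. }
  (* The factor [s ^ k] is the one that the chain rule produces in the [k]-th derivative. *)
  assert (Hu0 : s ^ 0 * u 0%nat (x + s * b) = 0).
  { apply (bang_quasianalytic r b A
      (fun k z => s ^ k * u k (x + s * z)) rho Hr HA).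
    - intros n. apply exp_pos.
    - intros n. apply Rle_Rpower_l; [lra |]. split; [apply Hmu |].
      apply Rmult_le_compat_l; [lra | now apply mu_le].
    - intros m T.
      set (c := Rpower (/ h) (1 / INR r)) in *.
      assert (Hc : 0 < c) by apply exp_pos.
      destruct (not_ex_series_unbounded (root_series M r)) with (m := m)
        (T := T / c) as [K HK].
      + intros n. apply Rlt_le, exp_pos.
      + exact Hs.
      + exists K. apply Rle_div_l in HK; [| exact Hc].
        eapply Rle_trans; [exact HK |]. right.
        rewrite (sum_n_m_ext _ _ _ _ Hrho).
        rewrite (sum_n_m_mult_l (K := R_Ring) c). apply Rmult_comm.
    - intros k z Hz. simpl.
      replace (s * s ^ k * u (S k) (x + s * z))
        with (s ^ k * (s * u (S k) (x + s * z))) by ring.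
      apply derive_within_scal.
      apply (derive_within_affine I _ (u k) x s z); auto.
    - intros n z Hz. rewrite Rabs_mult, <- RPow_abs, Hs1, pow1, Rmult_1_l.
      rewrite prodR_blocks.
      rewrite (prodR_ext _ (fun i => h * mu M (S i))).
      2: { intros i. now apply Rpower_root. }
      rewrite prodR_mult, prodR_mu by exact HM.
      replace (prodR (fun _ => h) n) with (h ^ n).
      + now apply Hgr, Hseg.
      + clear. induction n; simpl; [reflexivity | rewrite <- IHn; ring].
    - intros k. rewrite Rmult_0_r, Rplus_0_r, Hflat. ring.
    - lra. }
  rewrite Hsb in Hu0. simpl in Hu0. lra.
Qed.

(** Uniqueness needs the bound for one [h] only: Roumieu type provides some [h], and for Beurling
    type [h = 1] is taken. *)
Lemma ramified_class_growth (t : growth_type) (I : R -> Prop) (r : nat)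
    (M : nat -> R) (f : R -> C) :
  LC M -> ramified_class t I r M f ->
  exists A h, 0 <= A /\ 0 < h /\ forall n x, I x ->
    Cmod (Derive_n_on I f (r * n) x) <= A * (h ^ n * M n).
Proof.
  intros (HM & _) (_ & _ & Hg).
  assert (K : exists h, 0 < h /\ growth_bound I r M f h).
  { destruct t; [exact Hg | exists 1; split; [lra | apply Hg; lra]]. }
  destruct K as (h & Hh & A & HA).
  exists (Rabs A), h. repeat split; [apply Rabs_pos | exact Hh |].
  intros n x Hx. specialize (HA n x Hx).
  assert (Hp : 0 < h ^ n * M n).
  { apply Rmult_lt_0_compat; [now apply pow_lt | apply HM]. }
  apply Rle_div_l in HA; [| exact Hp].
  eapply Rle_trans; [exact HA |]. apply Rmult_le_compat_r; [lra | apply Rle_abs].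
Qed.

Lemma ramified_quasianalytic (t : growth_type) (I : R -> Prop) (r : nat)
    (M : nat -> R) (A : (R -> C) -> Prop) :
  LC M -> (1 <= r)%nat -> convex I -> I 0 -> I 1 ->
  (forall f, A f -> ramified_class t I r M f) ->
  ~ ex_series (root_series M r) -> quasianalytic I A.
Proof.
  intros HM Hr HI I0 I1 HA Hs x Hx f g Hf Hg Hfg y Hy.
  apply HA in Hf. apply HA in Hg.
  pose proof (convex_no_isolated_point I HI I0 I1) as HI'.
  destruct (ramified_class_growth t I r M f HM Hf) as (a & h & Ha & Hh & Ba).
  destruct (ramified_class_growth t I r M g HM Hg) as (b & k & Hb & Hk & Bb).
  destruct Hf as (Sf & _). destruct Hg as (Sg & _).
  (* [p] stands for [Re] or [Im]; the flatness argument is applied to that part of [f - g], with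
     [a + b] and [h + k] as common constants. *)
  assert (Hcomp : forall p : C -> R,
    (forall z, Rabs (p z) <= Cmod z) ->
    (forall F z l, I z -> is_derive_on I F z l ->
      derive_within I (fun y => p (F y)) z (p l)) ->
    p (f y) = p (g y)).
  { intros p Hp Dp.
    assert (E : p (f y) + -1 * p (g y) = 0); [| lra].
    apply (flat_eq_0 M r I
      (fun n z => p (Derive_n_on I f n z) + -1 * p (Derive_n_on I g n z))
      (a + b) (h + k) x y); auto; try lra.
    - intros n z Hz. apply derive_within_plus; [| apply derive_within_scal];
        apply Dp; auto; now apply smooth_on_is_derive.
    - intros n z Hz.
      specialize (Ba n z Hz). specialize (Bb n z Hz).
      pose proof (Hp (Derive_n_on I f (r * n) z)).
      pose proof (Hp (Derive_n_on I g (r * n) z)).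
      pose proof (proj1 HM n) as HMn.
      assert (h ^ n * M n <= (h + k) ^ n * M n).
      { apply Rmult_le_compat_r; [lra |]. apply pow_incr; lra. }
      assert (k ^ n * M n <= (h + k) ^ n * M n).
      { apply Rmult_le_compat_r; [lra |]. apply pow_incr; lra. }
      eapply Rle_trans; [apply Rabs_triang |].
      rewrite Rabs_mult, (Rabs_left (-1)) by lra. nra.
    - intros n. pose proof (Hfg n) as E. unfold Borel in E. rewrite E. ring. }
  apply injective_projections.
  - apply (Hcomp Re).
    + intros z. exact (Rle_trans _ _ _ (Rmax_l _ _) (Rmax_Cmod z)).
    + intros F z l. apply is_derive_on_Re.
  - apply (Hcomp Im).
    + intros z. exact (Rle_trans _ _ _ (Rmax_r _ _) (Rmax_Cmod z)).
    + intros F z l. apply is_derive_on_Im.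
Qed.

(** * Bumps from infinite convolutions *)

Definition tail (a : nat -> R) (n : nat) : R := Series (fun i => a (n + i)%nat).

Lemma ex_series_tail (a : nat -> R) (n : nat) :
  ex_series a -> ex_series (fun i => a (n + i)%nat).
Proof. apply (ex_series_incr_n a n). Qed.

Lemma tail_step (a : nat -> R) (n : nat) :
  ex_series a -> tail a n = a n + tail a (S n).
Proof.
  intros Ha. unfold tail. rewrite Series_incr_1 by now apply ex_series_tail.
  rewrite Nat.add_0_r. f_equal. apply Series_ext. intros i. f_equal. lia.
Qed.

Lemma tail_ge_0 (a : nat -> R) (n : nat) :
  ex_series a -> (forall k, 0 <= a k) -> 0 <= tail a n.
Proof.
  intros Ha Hp. unfold tail.
  replace 0 with (Series (fun i => 0 * a (n + i)%nat)).
  - apply Series_le; [| now apply ex_series_tail].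
    intros i. pose proof (Hp (n + i)%nat). lra.
  - rewrite Series_scal_l. ring.
Qed.

Lemma is_lim_seq_tail (a : nat -> R) : ex_series a -> is_lim_seq (tail a) 0.
Proof.
  intros Ha. apply is_lim_seq_incr_1.
  apply is_lim_seq_ext with (fun n => Series a - sum_n a n).
  - intros n. unfold tail. rewrite (Series_incr_n a (S n)) by (lia || easy).
    simpl pred. rewrite sum_n_Reals. ring.
  - replace 0 with (Series a - Series a) by ring.
    apply is_lim_seq_minus'; [apply is_lim_seq_const |].
    exact (Series_correct a Ha).
Qed.

Lemma tail_small (a : nat -> R) (eps : R) :
  ex_series a -> 0 < eps -> exists N, forall n, (N <= n)%nat -> tail a n < eps.
Proof.
  intros Ha He.
  destruct (proj2 (is_lim_seq_spec _ _) (is_lim_seq_tail a Ha) (mkposreal eps He))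
    as [N HN].
  exists N. intros n Hn. specialize (HN n Hn). simpl in HN.
  rewrite Rminus_0_r in HN. apply Rabs_def2 in HN. lra.
Qed.

(** Passage to the limit: an inequality between limits of averages follows once it holds up to two
    tail errors for every [n]. *)
Lemma le_of_tail (a : nat -> R) (x y c : R) (k : nat) :
  ex_series a -> (forall n, x <= y + 2 * tail a (k + n)) -> x <= y.
Proof.
  intros Ha H. destruct (Rle_dec x y) as [L | L]; [exact L | exfalso].
  destruct (tail_small a ((x - y) / 2) Ha) as [N HN]; [lra |].
  specialize (H N). specialize (HN (k + N)%nat ltac:(lia)). lra.
Qed.

(** * Moving averages of nonexpansive functions *)

Definition nonexpansive (f : R -> R) : Prop :=
  forall x y, Rabs (f x - f y) <= Rabs (x - y).

Lemma nonexpansive_continuous (f : R -> R) (x : R) :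
  nonexpansive f -> continuous f x.
Proof.
  intros Hf. apply continuity_pt_filterlim. intros eps He. exists eps.
  split; [exact He |]. intros y [_ Hy]. simpl in *. unfold Rdist in *.
  eapply Rle_lt_trans; [apply Hf | exact Hy].
Qed.

Lemma nonexpansive_ex_RInt (f : R -> R) (a b : R) :
  nonexpansive f -> ex_RInt f a b.
Proof.
  intros Hf. apply (ex_RInt_continuous (V := R_CompleteNormedModule)).
  intros x _. now apply nonexpansive_continuous.
Qed.

(** Convolution of [f] with the normalized indicator function of [[- a, a]]; [diffop] below is its
    derivative. *)
Definition avg (a : R) (f : R -> R) (x : R) : R :=
  RInt f (x - a) (x + a) / (2 * a).

Definition diffop (a : R) (f : R -> R) (x : R) : R :=
  (f (x + a) - f (x - a)) / (2 * a).

Lemma avg_dist (a e : R) (f g : R -> R) (x : R) :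
  0 < a -> nonexpansive f -> nonexpansive g ->
  (forall y, x - a <= y <= x + a -> Rabs (f y - g y) <= e) ->
  Rabs (avg a f x - avg a g x) <= e.
Proof.
  intros Ha Hf Hg H. unfold avg.
  assert (Ff := nonexpansive_ex_RInt f (x - a) (x + a) Hf).
  assert (Fg := nonexpansive_ex_RInt g (x - a) (x + a) Hg).
  assert (K := is_RInt_minus f g _ _ _ _ (RInt_correct f _ _ Ff)
    (RInt_correct g _ _ Fg)).
  assert (L := norm_RInt_le_const (fun y => minus (f y) (g y))
    (x - a) (x + a) _ e ltac:(lra) H K).
  change (Rabs (RInt f (x - a) (x + a) - RInt g (x - a) (x + a))
    <= (x + a - (x - a)) * e) in L.
  replace (RInt f (x - a) (x + a) / (2 * a) - RInt g (x - a) (x + a) / (2 * a))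
    with ((RInt f (x - a) (x + a) - RInt g (x - a) (x + a)) / (2 * a))
    by (field; lra).
  rewrite Rabs_div by lra. rewrite (Rabs_pos_eq (2 * a)) by lra.
  apply Rle_div_l; lra.
Qed.

Lemma avg_const (a c x : R) : 0 < a -> avg a (fun _ => c) x = c.
Proof.
  intros Ha. unfold avg. rewrite RInt_const. unfold scal; simpl.
  unfold mult; simpl. field. lra.
Qed.

(** Only the values on the window around [x] enter. This local form gives both the closeness of
    [avg a f] to [f] and the control of supports. *)
Lemma avg_near_const (a e c : R) (f : R -> R) (x : R) :
  0 < a -> nonexpansive f ->
  (forall y, x - a <= y <= x + a -> Rabs (f y - c) <= e) ->
  Rabs (avg a f x - c) <= e.
Proof.
  intros Ha Hf H. rewrite <- (avg_const a c x Ha) at 1.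
  apply avg_dist; auto.
  intros y z. rewrite Rminus_diag, Rabs_R0. apply Rabs_pos.
Qed.

(** The window integral is a difference of two values of the primitive based at [0], to which the
    fundamental theorem of calculus applies. *)
Lemma is_derive_avg (a : R) (f : R -> R) (x : R) :
  0 < a -> nonexpansive f -> is_derive (avg a f) x (diffop a f x).
Proof.
  intros Ha Hf. unfold avg, diffop.
  assert (F : forall p q, is_RInt f p q (RInt f p q)).
  { intros p q. apply (RInt_correct f). now apply nonexpansive_ex_RInt. }
  assert (D : forall y, is_derive (fun z => RInt f 0 z) y (f y)).
  { intros y. apply is_derive_RInt with (a := 0).
    - apply filter_forall. intros z. apply F.
    - now apply nonexpansive_continuous. }
  apply is_derive_ext with
    (fun y => (RInt f 0 (y + a) - RInt f 0 (y - a)) / (2 * a)).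
  - intros y. f_equal.
    rewrite <- (RInt_Chasles f 0 (y - a) (y + a)).
    + unfold plus; simpl. ring.
    + exists (RInt f 0 (y - a)). apply F.
    + exists (RInt f (y - a) (y + a)). apply F.
  - assert (D1 : is_derive (fun y => RInt f 0 (y + a)) x (1 * f (x + a))).
    { apply (is_derive_comp (fun z => RInt f 0 z) (fun y => y + a)).
      - apply D.
      - auto_derive; auto. }
    assert (D2 : is_derive (fun y => RInt f 0 (y - a)) x (1 * f (x - a))).
    { apply (is_derive_comp (fun z => RInt f 0 z) (fun y => y - a)).
      - apply D.
      - auto_derive; auto. }
    rewrite Rmult_1_l in D1, D2.
    apply is_derive_ext with
      (fun y => / (2 * a) * (RInt f 0 (y + a) - RInt f 0 (y - a))).
    + intros y. unfold Rdiv. apply Rmult_comm.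
    + unfold Rdiv. rewrite (Rmult_comm _ (/ _)).
      apply (is_derive_scal (fun y => RInt f 0 (y + a) - RInt f 0 (y - a))).
      exact (is_derive_minus _ _ _ _ _ D1 D2).
Qed.

(** The derivative [diffop a f] is bounded by [1], because [f] varies by at most [2 * a] over the
    window; then the mean value theorem applies. *)
Lemma nonexpansive_avg (a : R) (f : R -> R) :
  0 < a -> nonexpansive f -> nonexpansive (avg a f).
Proof.
  intros Ha Hf x y.
  destruct (MVT_gen (avg a f) y x (diffop a f)) as (c & _ & E).
  - intros z _. now apply is_derive_avg.
  - intros z _. apply continuity_pt_filterlim.
    apply (ex_derive_continuous (avg a f) z). exists (diffop a f z). now apply is_derive_avg.
  - rewrite E, Rabs_mult. rewrite <- (Rmult_1_l (Rabs (x - y))) at 2.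
    apply Rmult_le_compat_r; [apply Rabs_pos |].
    unfold diffop. rewrite Rabs_div by lra.
    rewrite (Rabs_pos_eq (2 * a)) by lra. apply Rle_div_l; [lra |].
    eapply Rle_trans; [apply Hf |]. rewrite Rabs_pos_eq; lra.
Qed.

Lemma avg_near (a : R) (f : R -> R) (x : R) :
  0 < a -> nonexpansive f -> Rabs (avg a f x - f x) <= a.
Proof.
  intros Ha Hf. apply avg_near_const; auto.
  intros y Hy. eapply Rle_trans; [apply Hf |]. apply Rabs_le_between'. lra.
Qed.

(** * Infinite iteration of averages *)

Fixpoint iter_avg (a : nat -> R) (f : R -> R) (k n : nat) : R -> R :=
  match n with
  | O => f
  | S m => avg (a k) (iter_avg a f (S k) m)
  end.

(** The limit of [iter_avg a f k n] in [n], written as a telescoping series. The outermost average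
    has step [a k], so that it can be split off the limit. *)
Definition limit_avg (a : nat -> R) (f : R -> R) (k : nat) (x : R) : R :=
  f x + Series (fun i => iter_avg a f k (S i) x - iter_avg a f k i x).

Section InfiniteAverage.

Variables (a : nat -> R) (f : R -> R).
Hypothesis (a_pos : forall k, 0 < a k) (a_sum : ex_series a)
  (f_nonexp : nonexpansive f).

Lemma nonexpansive_iter_avg (n k : nat) : nonexpansive (iter_avg a f k n).
Proof.
  revert k. induction n as [| n IH]; intros k; [exact f_nonexp |].
  now apply nonexpansive_avg.
Qed.

(** The two iterates differ only in an innermost average of step [a (k + n)], which moves [f] by at
    most that much; the outer averages do not increase the distance. *)
Lemma iter_avg_step (n k : nat) (x : R) :
  Rabs (iter_avg a f k (S n) x - iter_avg a f k n x) <= a (k + n)%nat.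
Proof.
  revert k x. induction n as [| n IH]; intros k x.
  - rewrite Nat.add_0_r. now apply avg_near.
  - rewrite Nat.add_succ_r.
    apply (avg_dist (a k) _ (iter_avg a f (S k) (S n)) (iter_avg a f (S k) n));
      auto using nonexpansive_iter_avg.
Qed.

Lemma limit_avg_near (n k : nat) (x : R) :
  Rabs (limit_avg a f k x - iter_avg a f k n x) <= tail a (k + n).
Proof.
  set (d := fun i => iter_avg a f k (S i) x - iter_avg a f k i x).
  assert (Hd : forall i, Rabs (d i) <= a (k + i)%nat).
  { intros i. exact (iter_avg_step i k x). }
  assert (Ed : ex_series (fun i => Rabs (d (n + i)%nat))).
  { apply (ex_series_le (V := R_CompleteNormedModule))
      with (fun i => a (k + n + i)%nat).
    - intros i. change (Rabs (Rabs (d (n + i)%nat)) <= a (k + n + i)%nat).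
      rewrite Rabs_Rabsolu, <- Nat.add_assoc. apply Hd.
    - now apply ex_series_tail. }
  assert (E : limit_avg a f k x - iter_avg a f k n x
    = Series (fun i => d (n + i)%nat)).
  { unfold limit_avg. fold d. clear Ed. induction n as [| m IH].
    - simpl. ring_simplify. reflexivity.
    - assert (Ed : ex_series (fun i => d (m + i)%nat)).
      { apply (ex_series_le (V := R_CompleteNormedModule))
          with (fun i => a (k + m + i)%nat).
        - intros i. rewrite <- Nat.add_assoc. exact (Hd (m + i)%nat).
        - now apply ex_series_tail. }
      rewrite (Series_incr_1 (fun i => d (m + i)%nat) Ed), Nat.add_0_r in IH.
      rewrite (Series_ext (fun i => d (S m + i)%nat) (fun i => d (m + S i)%nat)).
      + unfold d at 2 in IH. lra.
      + intros i. f_equal. lia. }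
  rewrite E. eapply Rle_trans; [now apply Series_Rabs |].
  apply Series_le; [| now apply ex_series_tail].
  intros i. split; [apply Rabs_pos |]. rewrite <- Nat.add_assoc. apply Hd.
Qed.

Lemma nonexpansive_limit_avg (k : nat) : nonexpansive (limit_avg a f k).
Proof.
  intros x y. apply (le_of_tail a _ _ 0 k a_sum). intros n.
  pose proof (limit_avg_near n k x) as Hx.
  pose proof (limit_avg_near n k y) as Hy.
  pose proof (nonexpansive_iter_avg n k x y) as Hn.
  apply Rabs_le_between in Hx, Hy, Hn. apply Rabs_le_between. lra.
Qed.

(** Both sides are within [tail a (S k + n)] of [iter_avg a f k (S n) x], for every [n]. *)
Lemma limit_avg_fixpoint (k : nat) (x : R) :
  limit_avg a f k x = avg (a k) (limit_avg a f (S k)) x.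
Proof.
  assert (H : Rabs (limit_avg a f k x - avg (a k) (limit_avg a f (S k)) x) <= 0).
  { apply (le_of_tail a _ _ 0 (S k) a_sum). intros n.
    pose proof (limit_avg_near (S n) k x) as Hx.
    assert (Hy : Rabs (avg (a k) (limit_avg a f (S k)) x
        - iter_avg a f k (S n) x) <= tail a (S k + n)).
    { apply avg_dist; auto using nonexpansive_limit_avg, nonexpansive_iter_avg.
      intros y _. apply limit_avg_near. }
    rewrite Nat.add_succ_r in Hx.
    apply Rabs_le_between in Hx, Hy. apply Rabs_le_between.
    change (S k + n)%nat with (S (k + n)) in *. lra. }
  apply Rabs_le_between in H. lra.
Qed.

Lemma is_derive_limit_avg (k : nat) (x : R) :
  is_derive (limit_avg a f k) x (diffop (a k) (limit_avg a f (S k)) x).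
Proof.
  apply is_derive_ext with (avg (a k) (limit_avg a f (S k))).
  - intros y. symmetry. apply limit_avg_fixpoint.
  - apply is_derive_avg; auto using nonexpansive_limit_avg.
Qed.

(** Each average of step [a i] widens the support by [a i] on both sides, hence all of them together
    by [tail a k]. *)
Lemma limit_avg_support (c w : R) (k : nat) (x : R) :
  (forall y, w <= Rabs (y - c) -> f y = 0) ->
  w + tail a k <= Rabs (x - c) -> limit_avg a f k x = 0.
Proof.
  intros Hf Hx.
  assert (H : forall n k x, w + tail a k <= Rabs (x - c) ->
    iter_avg a f k n x = 0).
  { clear k x Hx. induction n as [| n IH]; intros k x Hx.
    - apply Hf. pose proof (tail_ge_0 a k a_sum (fun i => Rlt_le _ _ (a_pos i))).
      simpl. lra.
    - assert (L : Rabs (avg (a k) (iter_avg a f (S k) n) x - 0) <= 0).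
      { apply avg_near_const; auto using nonexpansive_iter_avg.
        intros y Hy. rewrite IH, Rminus_0_r, Rabs_R0; [apply Rle_refl |].
        rewrite tail_step in Hx by auto.
        assert (Hxy : Rabs (x - y) <= a k) by (apply Rabs_le_between; lra).
        pose proof (Rabs_triang (x - y) (y - c)) as T.
        replace (x - y + (y - c)) with (x - c) in T by ring. lra. }
      rewrite Rminus_0_r in L.
      pose proof (Rabs_pos (avg (a k) (iter_avg a f (S k) n) x)).
      apply Rabs_eq_0. simpl. lra. }
  assert (L : Rabs (limit_avg a f k x) <= 0).
  { apply (le_of_tail a _ _ 0 k a_sum). intros n.
    pose proof (limit_avg_near n k x) as Hl.
    rewrite H, Rminus_0_r in Hl by auto.
    pose proof (Rabs_pos (limit_avg a f k x)). lra. }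
  apply Rabs_le_between in L. lra.
Qed.

End InfiniteAverage.

(** * Iterated difference quotients and the bump *)

Fixpoint diffs (a : nat -> R) (k : nat) (f : R -> R) : R -> R :=
  match k with
  | O => f
  | S m => diffs a m (diffop (a m) f)
  end.

(** Difference quotients are combinations of translates, so they commute with differentiation. *)
Lemma is_derive_diffs (a : nat -> R) (k : nat) (f df : R -> R) :
  (forall x, is_derive f x (df x)) ->
  forall x, is_derive (diffs a k f) x (diffs a k df x).
Proof.
  revert f df. induction k as [| k IH]; intros f df H; [exact H |].
  simpl. apply IH. intros x. unfold diffop, Rdiv.
  rewrite (Rmult_comm _ (/ _)).
  apply is_derive_ext with (fun y => / (2 * a k) * (f (y + a k) - f (y - a k))).
  { intros y. apply Rmult_comm. }
  apply (is_derive_scal (fun y => f (y + a k) - f (y - a k))).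
  apply (is_derive_minus (fun y => f (y + a k)) (fun y => f (y - a k))).
  - rewrite <- (Rmult_1_l (df _)).
    apply (is_derive_comp f (fun y => y + a k)); [apply H | auto_derive; auto].
  - rewrite <- (Rmult_1_l (df _)).
    apply (is_derive_comp f (fun y => y - a k)); [apply H | auto_derive; auto].
Qed.

Lemma diffs_bound (a : nat -> R) (B : R) (k : nat) (f : R -> R) :
  (forall i, 0 < a i) -> (forall x, Rabs (f x) <= B) ->
  forall x, Rabs (diffs a k f x) <= B / prodR a k.
Proof.
  intros Ha. revert B f. induction k as [| k IH]; intros B f Hf x; simpl.
  - rewrite Rdiv_1_r. apply Hf.
  - pose proof (Ha k). pose proof (prodR_pos a k Ha).
    replace (B / (prodR a k * a k)) with (B / a k / prodR a k) by (field; lra).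
    apply IH. intros y. unfold diffop. rewrite Rabs_div by lra.
    rewrite (Rabs_pos_eq (2 * a k)) by lra.
    apply Rle_div_l; [lra |].
    replace (B / a k * (2 * a k)) with (2 * B) by (field; lra).
    pose proof (Hf (y + a k)). pose proof (Hf (y - a k)).
    eapply Rle_trans; [apply Rabs_triang |]. rewrite Rabs_Ropp. lra.
Qed.

(** The starting function of the averages: a tent of height [1 / 8] over [[3/8, 5/8]], with slopes
    [1] and [-1]. *)
Definition hat (x : R) : R := Rmax 0 (1 / 8 - Rabs (x - 1 / 2)).

Lemma nonexpansive_hat : nonexpansive hat.
Proof.
  intros x y. unfold hat, Rmax.
  do 2 destruct Rle_dec; unfold Rabs in *; repeat destruct Rcase_abs; lra.
Qed.

Lemma exists_bump (a : nat -> R) :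
  (forall k, 0 < a k) -> ex_series a -> Series a <= 1 / 16 ->
  exists g : nat -> R -> R,
    (forall k x, is_derive (g k) x (g (S k) x)) /\
    (forall k x, x < 1 / 4 \/ 3 / 4 < x -> g k x = 0) /\
    (forall k x, Rabs (g k x) <= / prodR a k) /\
    g 0%nat (1 / 2) <> 0.
Proof.
  intros Ha Hs Hs16.
  set (psi := limit_avg a hat).
  assert (Ht : forall k, 0 <= tail a k <= 1 / 16).
  { assert (H0 : forall k, 0 <= tail a k).
    { intros k. apply tail_ge_0; auto. intros i. now apply Rlt_le. }
    intros k. split; [apply H0 |]. induction k as [| k IH]; [exact Hs16 |].
    pose proof (tail_step a k Hs). pose proof (Ha k). lra. }
  assert (Hnear : forall k x, Rabs (psi k x - hat x) <= 1 / 16).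
  { intros k x.
    pose proof (limit_avg_near a hat Ha Hs nonexpansive_hat 0 k x) as K.
    rewrite Nat.add_0_r in K. pose proof (Ht k). simpl in K. unfold psi. lra. }
  (* Differentiating [psi k] yields [diffop (a k) (psi (S k))]; [diffs] applies this new quotient
     first, so the next derivative has the same form. *)
  exists (fun k => diffs a k (psi k)).
  assert (D : forall k x,
    is_derive (diffs a k (psi k)) x (diffs a (S k) (psi (S k)) x)).
  { intros k. apply (is_derive_diffs a k (psi k) (diffop (a k) (psi (S k)))).
    intros x. now apply is_derive_limit_avg; auto using nonexpansive_hat. }
  split; [exact D | split; [| split]].
  (* For [k = 0] the support radius is at most [1 / 8 + 1 / 16 < 1 / 4]. The set of the [x] in
     question is open, so the vanishing passes to derivatives. *)
  - induction k as [| k IH]; intros x Hx.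
    + apply (limit_avg_support a hat Ha Hs nonexpansive_hat (1 / 2) (1 / 8)).
      * intros y Hy. unfold hat. apply Rmax_left. lra.
      * pose proof (Ht 0%nat). unfold Rabs; destruct Rcase_abs; lra.
    + rewrite <- (is_derive_unique _ _ _ (D k x)).
      rewrite (Derive_ext_loc _ (fun _ => 0)); [apply Derive_const |].
      destruct Hx as [Hx | Hx].
      * apply filter_imp with (fun y => y < 1 / 4); [auto |].
        now apply (open_lt (1 / 4)).
      * apply filter_imp with (fun y => 3 / 4 < y); [auto |].
        now apply (open_gt (3 / 4)).
  - intros k x. rewrite <- (Rmult_1_l (/ _)).
    apply (diffs_bound a 1 k (psi k) Ha). intros y.
    specialize (Hnear k y). unfold hat, Rmax in Hnear.
    pose proof (Rabs_pos (y - 1 / 2)).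
    apply Rabs_le_between in Hnear. apply Rabs_le_between.
    destruct Rle_dec; lra.
  (* At the top of the tent the value is at least [1 / 8 - 1 / 16]. *)
  - simpl. specialize (Hnear 0%nat (1 / 2)). unfold hat in Hnear.
    rewrite Rminus_diag, Rabs_R0, Rminus_0_r, Rmax_right in Hnear by lra.
    apply Rabs_le_between in Hnear. lra.
Qed.

(** * Nonquasianalyticity when the series converges *)

(* Abel-Dini: dividing the terms by the square root of the tail preserves
   convergence, because [t n / sqrt (tail t n)] is at most
   [2 * (sqrt (tail t n) - sqrt (tail t (S n)))]. *)
Lemma ex_series_div_sqrt_tail (t : nat -> R) :
  (forall n, 0 < t n) -> ex_series t ->
  ex_series (fun n => t n / sqrt (tail t n)).
Proof.
  intros Ht Hs.
  assert (Hge : forall n, 0 <= tail t n).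
  { intros n. apply tail_ge_0; auto. intros k. now apply Rlt_le. }
  assert (Hpos : forall n, 0 < sqrt (tail t n)).
  { intros n. apply sqrt_lt_R0. rewrite tail_step by auto.
    pose proof (Ht n). pose proof (Hge (S n)). lra. }
  assert (Hle : forall n, t n / sqrt (tail t n)
    <= 2 * (sqrt (tail t n) - sqrt (tail t (S n)))).
  { intros n. apply Rle_div_l; [apply Hpos |].
    pose proof (Hpos n). pose proof (Hpos (S n)). pose proof (Ht n).
    pose proof (sqrt_sqrt _ (Hge n)) as E1.
    pose proof (sqrt_sqrt _ (Hge (S n))) as E2.
    pose proof (tail_step t n Hs) as E.
    assert (sqrt (tail t (S n)) <= sqrt (tail t n)) by (apply sqrt_le_1_alt; lra).
    nra. }
  assert (Hfin : ex_finite_lim_seq (sum_n (fun n => t n / sqrt (tail t n)))).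
  { apply ex_finite_lim_seq_incr with (M := 2 * sqrt (tail t 0)).
    - intros n. rewrite sum_Sn. unfold plus; simpl.
      pose proof (Rdiv_lt_0_compat _ _ (Ht (S n)) (Hpos (S n))). lra.
    - intros n. apply Rle_trans with
        (2 * (sqrt (tail t 0) - sqrt (tail t (S n)))).
      + induction n as [| n IH]; [rewrite sum_O; apply Hle |].
        rewrite sum_Sn. unfold plus; simpl. pose proof (Hle (S n)). lra.
      + pose proof (Hpos (S n)). lra. }
  destruct Hfin as [l Hl]. now exists l.
Qed.

Lemma ex_series_blocks (d : nat -> R) (r : nat) :
  (1 <= r)%nat -> (forall n, 0 < d n) -> ex_series d ->
  ex_series (fun k => d (k / r)%nat).
Proof.
  intros Hr Hd [l Hl].
  assert (Hmon : forall n, sum_n d n <= sum_n d (S n)).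
  { intros n. rewrite sum_Sn. unfold plus; simpl. pose proof (Hd (S n)). lra. }
  assert (Hpart : forall n, sum_n d n <= l).
  { intros n. exact (is_lim_seq_incr_compare (sum_n d) l Hl Hmon n). }
  assert (Hmon' : forall n, sum_n (fun k => d (k / r)%nat) n
      <= sum_n (fun k => d (k / r)%nat) (S n)).
  { intros n. rewrite sum_Sn. unfold plus; simpl.
    pose proof (Hd (S n / r)%nat). lra. }
  (* Up to index [r * n + j] the value [d n] has occurred [j + 1] times, so [r - (j + 1)] copies are
     missing from [r] full ones. *)
  assert (Hblock : forall n j, (j < r)%nat ->
    sum_n (fun k => d (k / r)%nat) (r * n + j)
      <= INR r * sum_n d n - INR (r - S j) * d n).
  { induction n as [| n IHn]; induction j as [| j IHj]; intros Hj.
    - rewrite Nat.mul_0_r, !sum_O, Nat.Div0.div_0_l.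
      rewrite minus_INR by lia. rewrite INR_1. lra.
    - rewrite Nat.add_succ_r, sum_Sn. change plus with Rplus.
      rewrite <- Nat.add_succ_r, block_index by lia.
      specialize (IHj ltac:(lia)).
      replace (r - S j)%nat with (S (r - S (S j))) in IHj by lia.
      rewrite S_INR in IHj. lra.
    - specialize (IHn (r - 1)%nat ltac:(lia)).
      replace (r - S (r - 1))%nat with 0%nat in IHn by lia.
      replace (r * S n + 0)%nat with (S (r * n + (r - 1))) by lia.
      rewrite !sum_Sn. change plus with Rplus.
      replace (S (r * n + (r - 1))) with (r * S n + 0)%nat by lia.
      rewrite block_index by lia.
      rewrite minus_INR by lia. rewrite INR_1. simpl INR in IHn. lra.
    - rewrite Nat.add_succ_r, (sum_Sn _ (r * S n + j)). change plus with Rplus.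
      rewrite <- Nat.add_succ_r, block_index by lia.
      specialize (IHj ltac:(lia)).
      replace (r - S j)%nat with (S (r - S (S j))) in IHj by lia.
      rewrite S_INR in IHj. lra. }
  assert (Hfin : ex_finite_lim_seq (sum_n (fun k => d (k / r)%nat))).
  { apply ex_finite_lim_seq_incr with (M := INR r * l); [exact Hmon' |].
    intros n. pose proof (Nat.div_mod_eq n r) as E.
    pose proof (Nat.mod_upper_bound n r ltac:(lia)) as Hlt.
    rewrite E at 1.
    eapply Rle_trans; [now apply Hblock |].
    pose proof (pos_INR r). pose proof (pos_INR (r - S (n mod r))).
    pose proof (Hd (n / r)%nat). pose proof (Hpart (n / r)%nat). nra. }
  destruct Hfin as [l' Hl']. now exists l'.
Qed.

Lemma prodR_geometric_bound (e : nat -> R) (h : R) :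
  (forall n, 0 < e n) -> is_lim_seq e 0 -> 0 < h ->
  exists C, 0 <= C /\ forall n, prodR e n <= C * h ^ n.
Proof.
  intros He Hlim Hh.
  destruct (proj2 (is_lim_seq_spec _ _) Hlim (mkposreal h Hh)) as [N HN].
  (* [p n] collects the excess of the factors over [h]; from [N] on the factors are below [h], so
     [p] stays constant. *)
  set (p := prodR (fun k => Rmax 1 (e k / h))).
  assert (Hp1 : forall n, 1 <= p n).
  { induction n as [| n IH]; [apply Rle_refl |].
    pose proof (Rmax_l 1 (e n / h)). unfold p in *; simpl. nra. }
  assert (Hp : forall n, p n <= p N).
  { assert (Hinc : forall n, p n <= p (S n)).
    { intros n. pose proof (Rmax_l 1 (e n / h)). pose proof (Hp1 n).
      unfold p in *; simpl. nra. }
    assert (Hst : forall n, (N <= n)%nat -> p (S n) = p n).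
    { intros n Hn. unfold p; simpl. rewrite Rmax_left; [ring |].
      apply Rle_div_l; [exact Hh |]. specialize (HN n Hn). simpl in HN.
      rewrite Rminus_0_r in HN. apply Rabs_def2 in HN. lra. }
    intros n. destruct (Nat.le_gt_cases N n) as [Hn | Hn].
    - induction Hn; [apply Rle_refl | rewrite Hst; auto].
    - apply Nat.lt_le_incl in Hn. clear Hst HN. induction Hn; [apply Rle_refl |].
      exact (Rle_trans _ _ _ IHHn (Hinc _)). }
  exists (p N). split; [pose proof (Hp1 N); lra |].
  intros n. apply Rle_trans with (p n * h ^ n).
  - induction n as [| n IH]; [simpl; unfold p; simpl; lra |].
    unfold p in *; simpl.
    replace (prodR (fun k => Rmax 1 (e k / h)) n * Rmax 1 (e n / h) * (h * h ^ n))
      with (prodR (fun k => Rmax 1 (e k / h)) n * h ^ n * (Rmax 1 (e n / h) * h))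
      by ring.
    apply Rmult_le_compat; [apply Rlt_le, prodR_pos, He | apply Rlt_le, He | exact IH |].
    apply Rle_div_l; [exact Hh | apply Rmax_r].
  - apply Rmult_le_compat_r; [apply pow_le; lra | apply Hp].
Qed.

(** For [i = k / r] the choice of steps gives [1 / a_k ^ r = (w_i / c) ^ r * mu_(i+1)]. The second
    factors multiply to [M n]; the first tend to [0], so their product is [O(h ^ n)] for every
    [h]. *)
Lemma exists_steps (M : nat -> R) (r : nat) :
  LC M -> (1 <= r)%nat -> ex_series (root_series M r) ->
  exists a : nat -> R,
    (forall k, 0 < a k) /\ ex_series a /\ Series a <= 1 / 16 /\
    forall h, 0 < h -> exists C, 0 <= C /\
      forall n, / prodR a (r * n) <= C * (h ^ n * M n).
Proof.
  intros HM Hr Hs.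
  set (t := root_series M r) in *.
  assert (Ht : forall n, 0 < t n) by (intros n; apply exp_pos).
  set (w n := sqrt (tail t n)).
  assert (Hw : forall n, 0 < w n).
  { intros n. apply sqrt_lt_R0. rewrite tail_step by auto.
    pose proof (Ht n).
    pose proof (tail_ge_0 t (S n) Hs (fun i => Rlt_le _ _ (Ht i))). lra. }
  set (b := fun k => t (k / r)%nat / w (k / r)%nat).
  assert (Hb : forall k, 0 < b k) by (intros k; now apply Rdiv_lt_0_compat).
  assert (Sb : ex_series b).
  { apply (ex_series_blocks (fun n => t n / w n) r Hr).
    - intros n. now apply Rdiv_lt_0_compat.
    - now apply ex_series_div_sqrt_tail. }
  assert (Hb0 : 0 <= Series b).
  { apply (tail_ge_0 b 0 Sb). intros k. now apply Rlt_le. }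
  (* This scaling brings the sum of the steps below [1 / 16], as the bump requires. *)
  set (c := 1 / 16 / (Series b + 1)).
  assert (Hc : 0 < c) by (apply Rdiv_lt_0_compat; lra).
  exists (fun k => c * b k). split; [| split; [| split]].
  - intros k. now apply Rmult_lt_0_compat.
  - exact (ex_series_scal_l c b Sb).
  - rewrite Series_scal_l. unfold c.
    replace (1 / 16 / (Series b + 1) * Series b)
      with (1 / 16 * Series b / (Series b + 1)) by (field; lra).
    apply Rle_div_l; lra.
  - intros h Hh.
    destruct (prodR_geometric_bound (fun n => (w n / c) ^ r) h) as (C & HC & HCn).
    + intros n. now apply pow_lt, Rdiv_lt_0_compat.
    + assert (L : is_lim_seq (fun n => w n / c) 0).
      { replace 0 with (sqrt 0 * / c) by (rewrite sqrt_0; ring).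
        apply is_lim_seq_mult'; [| apply is_lim_seq_const].
        apply (is_lim_seq_continuous sqrt (tail t) 0).
        - apply continuity_pt_sqrt. lra.
        - now apply is_lim_seq_tail. }
      (* The limit [0 ^ r] is [0] because [r >= 1]. *)
      destruct r as [| q]; [lia |].
      replace 0 with (0 ^ S q) by (simpl; ring).
      apply (is_lim_seq_continuous (fun x => x ^ S q) (fun n => w n / c) 0); auto.
      apply derivable_continuous_pt, derivable_pt_pow.
    + exact Hh.
    + exists C. split; [exact HC |]. intros n. unfold b.
      rewrite (prodR_blocks (fun i => c * (t i / w i)) r n), <- prodR_inv.
      rewrite (prodR_ext _ (fun i => (w i / c) ^ r * mu M (S i))).
      * rewrite prodR_mult, prodR_mu by exact HM.
        rewrite <- Rmult_assoc. apply Rmult_le_compat_r; [| apply HCn].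
        apply Rlt_le, HM.
      * intros i. pose proof (Hw i). pose proof (Ht i). pose proof (mu_pos M i HM).
        replace (mu M (S i)) with (/ (t i ^ r)).
        -- rewrite <- !pow_inv, <- Rpow_mult_distr. f_equal. field. lra.
        -- unfold t, root_series. rewrite Rpower_root; auto.
           ++ field. lra.
           ++ apply Rdiv_lt_0_compat; lra.
Qed.

(** The bounds hold for every [h], which is the Beurling condition and, with [h = 1], yields the
    Roumieu one. *)
Lemma bump_ramified (t : growth_type) (I : R -> Prop) (r : nat) (M : nat -> R)
    (g : nat -> R -> R) :
  LC M -> no_isolated_point I -> I 0 ->
  (forall k x, is_derive (g k) x (g (S k) x)) ->
  (forall k, g k 0 = 0) ->
  (forall h, 0 < h -> exists C, 0 <= C /\
    forall n x, Rabs (g (r * n)%nat x) <= C * (h ^ n * M n)) ->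
  ramified_class t I r M (fun x => RtoC (g 0%nat x)).
Proof.
  intros (HM & _) HI I0 Hder H0 Hgr.
  assert (Hw : forall n y, I y -> derive_within I (g n) y (g (S n) y)).
  { intros n y _. apply is_derive_derive_within, Hder. }
  split; [now apply smooth_on_RtoC | split].
  - intros n j _. rewrite Derive_n_on_RtoC by auto. now rewrite H0.
  - assert (K : forall h, 0 < h ->
      growth_bound I r M (fun x => RtoC (g 0%nat x)) h).
    { intros h Hh. destruct (Hgr h Hh) as (C & _ & HC). exists C.
      intros n x Hx. rewrite Derive_n_on_RtoC, Cmod_R by auto.
      apply Rle_div_l; [| apply HC].
      apply Rmult_lt_0_compat; [now apply pow_lt | apply HM]. }
    destruct t; [exists 1; split; [lra | apply K; lra] | exact K].
Qed.

Lemma ramified_nonquasianalytic (t : growth_type) (I : R -> Prop) (r : nat)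
    (M : nat -> R) (A : (R -> C) -> Prop) :
  LC M -> (1 <= r)%nat -> convex I -> I 0 -> I 1 ->
  (forall f, ramified_class t I r M f ->
    (forall x, x < 1 / 4 \/ 3 / 4 < x -> f x = 0%C) -> A f) ->
  ex_series (root_series M r) -> nonquasianalytic I A.
Proof.
  intros HM Hr HI I0 I1 HA Hs Hqa.
  pose proof (convex_no_isolated_point I HI I0 I1) as HI'.
  destruct (exists_steps M r HM Hr Hs) as (a & Ha & Sa & Sa16 & Hgr).
  destruct (exists_bump a Ha Sa Sa16) as (g & Dg & Og & Bg & Ng).
  assert (Kg : A (fun x => RtoC (g 0%nat x))).
  { apply HA.
    - apply bump_ramified; auto.
      + intros k. apply Og. lra.
      + intros h Hh. destruct (Hgr h Hh) as (C & HC & HCn).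
        exists C. split; [exact HC |].
        intros n x. exact (Rle_trans _ _ _ (Bg _ x) (HCn n)).
    - intros x Hx. now rewrite Og. }
  (* The bump is compared with the zero function: both are flat at [0] but they differ at
     [1 / 2]. *)
  assert (Kz : A (fun x => RtoC 0)).
  { apply HA; [| reflexivity].
    apply (bump_ramified t I r M (fun _ _ => 0)); auto.
    - intros k x. apply @is_derive_const.
    - intros h Hh. exists 0. split; [apply Rle_refl |].
      intros n x. rewrite Rabs_R0. lra. }
  apply Ng, RtoC_inj.
  apply (Hqa 0 I0 _ _ Kg Kz).
  - intros k. unfold Borel.
    rewrite Derive_n_on_RtoC by
      (auto; intros n y _; apply is_derive_derive_within, Dg).
    rewrite (Derive_n_on_RtoC I (fun _ _ => 0)) by
      (auto; intros n y _; apply is_derive_derive_within, @is_derive_const).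
    rewrite Og; [reflexivity | lra].
  - apply (HI 0 1); auto; lra.
Qed.

(** * The four classes *)

Lemma supp_included (I : R -> Prop) (f : R -> C) (a b : R) :
  (forall x, I x -> f x <> 0%C -> a <= x <= b) ->
  included (supp I f) (segment a b).
Proof.
  intros H x Hx.
  assert (K : forall e, 0 < e -> exists y, Rabs (y - x) < e /\ a <= y <= b).
  { intros e He.
    destruct (Hx (disc x (mkposreal e He))) as (y & Hy & Iy & Fy).
    - exists (mkposreal e He). intros z Hz. exact Hz.
    - exists y. split; [exact Hy | now apply H]. }
  split; apply Rnot_lt_le; intros L.
  - destruct (K (a - x)) as (y & Hy & Hab); [lra |].
    apply Rabs_def2 in Hy. lra.
  - destruct (K (x - b)) as (y & Hy & Hab); [lra |].
    apply Rabs_def2 in Hy. lra.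
Qed.

(** All four classes lie between the full ramified class, which gives uniqueness, and its members
    vanishing outside [[1/4, 3/4]], which include the bump. *)
Lemma nonquasianalytic_iff (t : growth_type) (I : R -> Prop) (r : nat)
    (M : nat -> R) (A : (R -> C) -> Prop) :
  LC M -> (1 <= r)%nat -> convex I -> I 0 -> I 1 ->
  (forall f, A f -> ramified_class t I r M f) ->
  (forall f, ramified_class t I r M f ->
    (forall x, x < 1 / 4 \/ 3 / 4 < x -> f x = 0%C) -> A f) ->
  nonquasianalytic I A <-> ex_series (root_series M r).
Proof.
  intros HM Hr HI I0 I1 HA1 HA2. split.
  - intros H. apply NNPP. intros Hs. apply H.
    now apply (ramified_quasianalytic t I r M).
  - now apply (ramified_nonquasianalytic t).
Qed.

Theorem theorem6p1 (M : nat -> R) (r : nat) (hM : LC M) (hr : (1 <= r)%nat)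
    (t : growth_type) :
  let summable :=
    ex_series (fun n => Rpower (1 / mu M (S n)) (1 / INR r)) in
  (nonquasianalytic line (class_D t r M) <-> summable) /\
  (nonquasianalytic half_line (class_L t r M) <-> summable) /\
  (nonquasianalytic half_line (class_N t r M) <-> summable) /\
  (nonquasianalytic (segment 0 1) (class_E t r M) <-> summable).
Proof.
  intros summable.
  assert (Hsupp : forall f : R -> C,
    (forall x, x < 1 / 4 \/ 3 / 4 < x -> f x = 0%C) ->
    forall x, f x <> 0%C -> 0 <= x <= 1).
  { intros f Hf x Hx. split; apply Rnot_lt_le; intros L; apply Hx, Hf; lra. }
  split; [| split; [| split]];
    apply (nonquasianalytic_iff t _ r M); auto;
    unfold convex, line, half_line, segment; try (intros; lra); auto.
  - now intros f [Hf _].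
  - intros f Hf H0. split; [exact Hf |].
    apply supp_included. intros x _ Hx. pose proof (Hsupp f H0 x Hx). lra.
  - now intros f [Hf _].
  - intros f Hf H0. split; [exact Hf |].
    apply supp_included. intros x _. now apply Hsupp.
Qed.
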